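(* Let $\sigma\in[-1,0)$ and let $F(a,b)=\operatorname{sgn}(\sigma)\,|A|^{\sigma}=-(a^2+b^2)^{\sigma/2}$ for $a,b>0$, where $|A|=(a^2+b^2)^{1/2}$. Then $$w(a,b)=\frac{(a-b)^2(a^3+b^3)(ab)^{\sigma}}{(a^2+b^2)^{1/2}(ab)^2}$$ is a maximum-principle function (MPF) for the normal velocity $F$.
   Context: Notation: $\mathbb{R}^2_+=(0,\infty)^2$; subscripts $a,b$ denote partial derivatives. Normal velocity: a symmetric function $F\in C^2(\mathbb{R}^2_+)$, homogeneous of some degree $\sigma\in\mathbb{R}\setminus\{0\}$, with $F_a,F_b>0$ for all $a,b>0$. It is contracting if $F>0$ everywhere on $\mathbb{R}^2_+$ and expanding if $F<0$ everywhere on $\mathbb{R}^2_+$. Maximum-principle function (MPF) for a normal velocity $F$: a symmetric function $w\in C^2(\mathbb{R}^2_+)$, homogeneous of some degree $\chi\in\mathbb{R}\setminus\{0\}$, such that, with $\alpha=-w_a/w_b$ and $\alpha_a=\partial\alpha/\partial a$ (defined for $a\ne b$): (1) $w>0$ whenever $a\neq b$, and $w=0$ whenever $a=b$. (2) $\chi>0$ if $F$ is contracting, $\chi<0$ if $F$ is expanding. (3) $w_a<0$ for all $0<a<b$, and $w_a>0$ for all $0<b<a$. (4) For all $a,b>0$ (for $E_w,G_w$: $a\neq b$) one has $C_w(a,b)\le0$, $E_w(a,b)\le0$, $G_w(a,b)\le 0$, where $$C_w=w_a\,a\big((F_aa^2+F_bb^2)+(F-F_aa-F_bb)a\big)+w_b\,b\big((F_aa^2+F_bb^2)+(F-F_aa-F_bb)b\big),$$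 $$E_w=w_a(F_{aa}+2F_{ab}\alpha+F_{bb}\alpha^2)-F_a(w_{aa}+2w_{ab}\alpha+w_{bb}\alpha^2)+2\,\frac{w_bF_a-w_aF_b}{a-b}\,\alpha^2,$$ $$G_w=\frac1{\alpha^2}\Big(w_b(F_{aa}+2F_{ab}\alpha+F_{bb}\alpha^2)-F_b(w_{aa}+2w_{ab}\alpha+w_{bb}\alpha^2)+2\,\frac{w_bF_a-w_aF_b}{a-b}\Big).$$ (5) There are constants $c>0$, $d\in\mathbb{R}$ such that, evaluating $\alpha$ and $\alpha_a$ at $(a,b)=(\rho,1)$ with $0<\rho<1$: if $F$ is contracting, then either $\alpha=c$ and $\alpha_a=0$ for all sufficiently small $\rho$, or, as $\rho\to0$, $\alpha=\frac c\rho+o(\rho^{-1})$ and $\alpha_a=-\frac c{\rho^2}+o(\rho^{-1})$; if $F$ is expanding, then, as $\rho\to0$, either $\alpha=\frac c\rho+o(\rho^{-1})$ and $\alpha_a=-\frac c{\rho^2}+o(\rho^{-1})$, or $\alpha=\frac{c+d\rho}{\rho^2}+o(\rho^{-1})$ and $\alpha_a=-\frac{2c+d\rho}{\rho^3}+o(\rho^{-1})$. *)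

(* Defs.v *)
From Stdlib Require Import Reals.
From Coquelicot Require Import Coquelicot.
Open Scope R_scope.

(* Functions on the open quadrant (0,oo)^2 are represented by total functions
   R -> R -> R, of which only the values at positive arguments matter. *)

(* [ex_diff_n f 2 a b] also asserts the continuity of f and of all its partial
   derivatives of order at most 2 at (a, b). *)
Definition C2_quadrant (f : R -> R -> R) : Prop :=
  forall a b, 0 < a -> 0 < b -> ex_diff_n f 2 a b.

Definition symmetric_quadrant (f : R -> R -> R) : Prop :=
  forall a b, 0 < a -> 0 < b -> f a b = f b a.

Definition homogeneous_quadrant (f : R -> R -> R) (deg : R) : Prop :=
  forall t a b, 0 < t -> 0 < a -> 0 < b ->
    f (t * a) (t * b) = Rpower t deg * f a b.

Notation d_a f := (partial_derive 1 0 f).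
Notation d_b f := (partial_derive 0 1 f).
Notation d_aa f := (partial_derive 2 0 f).
Notation d_ab f := (partial_derive 1 1 f).
Notation d_bb f := (partial_derive 0 2 f).

Record normal_velocity (F : R -> R -> R) : Prop := {
  nv_C2 : C2_quadrant F;
  nv_sym : symmetric_quadrant F;
  nv_hom : exists sigma, sigma <> 0 /\ homogeneous_quadrant F sigma;
  nv_mono : forall a b, 0 < a -> 0 < b -> 0 < d_a F a b /\ 0 < d_b F a b
}.

Definition contracting (F : R -> R -> R) : Prop :=
  forall a b, 0 < a -> 0 < b -> 0 < F a b.

Definition expanding (F : R -> R -> R) : Prop :=
  forall a b, 0 < a -> 0 < b -> F a b < 0.

Definition alpha (w : R -> R -> R) (a b : R) : R := - (d_a w a b / d_b w a b).

Definition D2_alpha (w f : R -> R -> R) (a b : R) : R :=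
  d_aa f a b + 2 * d_ab f a b * alpha w a b + d_bb f a b * (alpha w a b) ^ 2.

Definition C_term (F w : R -> R -> R) (a b : R) : R :=
  let P := d_a F a b * a ^ 2 + d_b F a b * b ^ 2 in
  let Q := F a b - d_a F a b * a - d_b F a b * b in
  d_a w a b * a * (P + Q * a) + d_b w a b * b * (P + Q * b).

Definition E_term (F w : R -> R -> R) (a b : R) : R :=
  d_a w a b * D2_alpha w F a b - d_a F a b * D2_alpha w w a b
  + 2 * ((d_b w a b * d_a F a b - d_a w a b * d_b F a b) / (a - b))
    * (alpha w a b) ^ 2.

Definition G_term (F w : R -> R -> R) (a b : R) : R :=
  / (alpha w a b) ^ 2 *
  (d_b w a b * D2_alpha w F a b - d_b F a b * D2_alpha w w a b
   + 2 * ((d_b w a b * d_a F a b - d_a w a b * d_b F a b) / (a - b))).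

(* f(rho) = g(rho) + o(1/rho) as rho -> 0+; [is_domin] takes the dominating
   function first. *)
Definition eq_up_to_o_inv (f g : R -> R) : Prop :=
  is_domin (at_right 0) (fun rho : R => / rho) (fun rho : R => f rho - g rho).

Definition alpha_constant (w : R -> R -> R) (c : R) : Prop :=
  at_right 0 (fun rho => alpha w rho 1 = c /\ d_a (alpha w) rho 1 = 0).

Definition alpha_first_order (w : R -> R -> R) (c : R) : Prop :=
  eq_up_to_o_inv (fun rho => alpha w rho 1) (fun rho => c / rho) /\
  eq_up_to_o_inv (fun rho => d_a (alpha w) rho 1) (fun rho => - (c / rho ^ 2)).

Definition alpha_second_order (w : R -> R -> R) (c d : R) : Prop :=
  eq_up_to_o_inv (fun rho => alpha w rho 1)
    (fun rho => (c + d * rho) / rho ^ 2) /\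
  eq_up_to_o_inv (fun rho => d_a (alpha w) rho 1)
    (fun rho => - ((2 * c + d * rho) / rho ^ 3)).

Record maximum_principle_function (F w : R -> R -> R) : Prop := {
  mpf_velocity : normal_velocity F;
  mpf_C2 : C2_quadrant w;
  mpf_sym : symmetric_quadrant w;
  mpf_hom : exists chi, chi <> 0 /\ homogeneous_quadrant w chi /\
    (contracting F -> 0 < chi) /\ (expanding F -> chi < 0);
  mpf_pos : forall a b, 0 < a -> 0 < b -> a <> b -> 0 < w a b;
  mpf_diag : forall a, 0 < a -> w a a = 0;
  mpf_decr : forall a b, 0 < a -> a < b -> d_a w a b < 0;
  mpf_incr : forall a b, 0 < b -> b < a -> 0 < d_a w a b;
  mpf_C : forall a b, 0 < a -> 0 < b -> C_term F w a b <= 0;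
  mpf_E : forall a b, 0 < a -> 0 < b -> a <> b -> E_term F w a b <= 0;
  mpf_G : forall a b, 0 < a -> 0 < b -> a <> b -> G_term F w a b <= 0;
  mpf_asymptotics : exists c d, 0 < c /\
    (contracting F -> alpha_constant w c \/ alpha_first_order w c) /\
    (expanding F -> alpha_first_order w c \/ alpha_second_order w c d)
}.

(* Main.v *)
Require Import Defs.
From Stdlib Require Import Reals Lra.
From Coquelicot Require Import Coquelicot.
Open Scope R_scope.

(** The logarithmic derivatives u = w_a/w and v = w_b/w are rational, and so is
    alpha = -u/v.  In D2_alpha w w the quadratic part (u + alpha v)^2 w drops
    out, so E is a positive, and C a negative, multiple of a polynomial in
    (a, b, sigma); G follows by symmetry from G(a, b) = E(b, a).  Writing r = -sigma and
    q = 1 + sigma, homogenising in (r, q) through q + r = 1, and substituting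
    a = b + t or b = a + t makes all coefficients of these polynomials have the
    required sign.  For the asymptotics, rho * alpha(rho, 1) extends to a C^1
    function at rho = 0 with value (2 - sigma)/(2 + sigma). *)

(** * Smoothness on the open quadrant *)

Inductive smooth : (R -> R -> R) -> Prop :=
| smooth_const c : smooth (fun _ _ => c)
| smooth_fst : smooth (fun a _ => a)
| smooth_snd : smooth (fun _ b => b)
| smooth_plus f g : smooth f -> smooth g -> smooth (fun a b => f a b + g a b)
| smooth_mult f g : smooth f -> smooth g -> smooth (fun a b => f a b * g a b)
| smooth_Rpower f p : smooth f -> (forall a b, 0 < a -> 0 < b -> 0 < f a b) ->
    smooth (fun a b => Rpower (f a b) p).

Lemma locally_pos a : 0 < a -> locally a (fun x => 0 < x).
Proof. exact (open_gt 0 a). Qed.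

Lemma locally_2d_quadrant (P : R -> R -> Prop) a b :
  0 < a -> 0 < b -> (forall x y, 0 < x -> 0 < y -> P x y) -> locally_2d P a b.
Proof.
intros Ha Hb HP; exists (mkposreal _ (Rmin_pos _ _ Ha Hb)); simpl; intros x y Hx Hy.
pose proof (Rmin_l a b); pose proof (Rmin_r a b).
apply Rabs_def2 in Hx; apply Rabs_def2 in Hy; apply HP; lra.
Qed.

Lemma is_derive_Rpower p x : 0 < x ->
  is_derive (fun t => Rpower t p) x (p * Rpower x (p - 1)).
Proof. intros; apply is_derive_Reals; now apply derivable_pt_lim_power. Qed.

Lemma smooth_continuity f : smooth f ->
  forall a b, 0 < a -> 0 < b -> continuity_2d_pt f a b.
Proof.
induction 1 as [c| | |f g _ IHf _ IHg|f g _ IHf _ IHg|f p _ IHf Hpos]; intros a b Ha Hb.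
- apply continuity_2d_pt_const.
- apply continuity_2d_pt_id1.
- apply continuity_2d_pt_id2.
- now apply continuity_2d_pt_plus; [apply IHf | apply IHg].
- now apply continuity_2d_pt_mult; [apply IHf | apply IHg].
- apply (continuity_1d_2d_pt_comp (fun t => Rpower t p)); [|now apply IHf].
  apply derivable_continuous_pt; eexists.
  now apply derivable_pt_lim_power; apply Hpos.
Qed.

Lemma smooth_swap f : smooth f -> smooth (fun a b => f b a).
Proof.
induction 1 as [c| | |f g _ IHf _ IHg|f g _ IHf _ IHg|f p _ IHf Hpos].
- apply smooth_const.
- apply smooth_snd.
- apply smooth_fst.
- exact (smooth_plus _ _ IHf IHg).
- exact (smooth_mult _ _ IHf IHg).
- apply (smooth_Rpower _ p IHf); auto.
Qed.

(** The syntactic class [smooth] exists for this closure property, proved by induction on the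
    expression. Positivity of the base is carried by [smooth_Rpower] because the derivative of a
    power contains another power of the same base. *)
Lemma smooth_derive_fst f : smooth f ->
  exists g, smooth g /\
    forall a b, 0 < a -> 0 < b -> is_derive (fun x => f x b) a (g a b).
Proof.
induction 1 as [c| | |f g _ [f' [Sf Hf]] _ [g' [Sg Hg]]
  |f g Sf0 [f' [Sf Hf]] Sg0 [g' [Sg Hg]]|f p Sf0 [f' [Sf Hf]] Hpos].
- exists (fun _ _ => 0); split; [apply smooth_const|].
  intros; apply (is_derive_const (V := R_NormedModule)).
- exists (fun _ _ => 1); split; [apply smooth_const|].
  intros; apply (is_derive_id (K := R_AbsRing)).
- exists (fun _ _ => 0); split; [apply smooth_const|].
  intros; apply (is_derive_const (V := R_NormedModule)).
- exists (fun a b => f' a b + g' a b); split; [now apply smooth_plus|].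
  intros a b Ha Hb.
  exact (is_derive_plus (fun x => f x b) _ _ _ _ (Hf a b Ha Hb) (Hg a b Ha Hb)).
- exists (fun a b => f' a b * g a b + f a b * g' a b); split.
    now apply smooth_plus; apply smooth_mult.
  intros a b Ha Hb.
  exact (is_derive_mult (fun x => f x b) (fun x => g x b) _ _ _
           (Hf a b Ha Hb) (Hg a b Ha Hb) Rmult_comm).
- exists (fun a b => f' a b * (p * Rpower (f a b) (p - 1))); split.
    apply smooth_mult; [easy|]; apply smooth_mult; [apply smooth_const|].
    now apply smooth_Rpower.
  intros a b Ha Hb.
  exact (is_derive_comp (fun t => Rpower t p) (fun x => f x b) a _ _
           (is_derive_Rpower p _ (Hpos a b Ha Hb)) (Hf a b Ha Hb)).
Qed.

Lemma smooth_derive_snd f : smooth f ->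
  exists g, smooth g /\
    forall a b, 0 < a -> 0 < b -> is_derive (fun y => f a y) b (g a b).
Proof.
intros [g [Sg Hg]]%smooth_swap%smooth_derive_fst.
exists (fun a b => g b a); split; [now apply smooth_swap|].
intros a b Ha Hb; now apply Hg.
Qed.

Lemma smooth_ex_diff_n n : forall f, smooth f ->
  forall a b, 0 < a -> 0 < b -> ex_diff_n f n a b.
Proof.
induction n as [|n IH]; intros f Sf a b Ha Hb; simpl.
  now split; [apply smooth_continuity|].
destruct (smooth_derive_fst f Sf) as [f1 [Sf1 H1]].
destruct (smooth_derive_snd f Sf) as [f2 [Sf2 H2]].
repeat split.
- now apply smooth_continuity.
- now exists (f1 a b); apply H1.
- now exists (f2 a b); apply H2.
- apply (ex_diff_n_ext_loc f1); [|now apply IH].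
  apply locally_2d_quadrant; [easy..|]; intros x y Hx Hy.
  now symmetry; apply is_derive_unique, H1.
- apply (ex_diff_n_ext_loc f2); [|now apply IH].
  apply locally_2d_quadrant; [easy..|]; intros x y Hx Hy.
  now symmetry; apply is_derive_unique, H2.
Qed.

(** [smooth] has no constructor for roots or quotients; F and w inherit regularity from a member of
    the class that agrees with them on the quadrant. *)
Lemma C2_quadrant_smooth f g : smooth g ->
  (forall a b, 0 < a -> 0 < b -> g a b = f a b) -> C2_quadrant f.
Proof.
intros Sg E a b Ha Hb; apply (ex_diff_n_ext_loc g).
  now apply locally_2d_quadrant.
now apply smooth_ex_diff_n.
Qed.

(** * Partial derivatives computed from [is_derive] *)

Lemma d_a_of f a b l : is_derive (fun x => f x b) a l -> d_a f a b = l.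
Proof. exact (is_derive_unique _ a l). Qed.

Lemma d_b_of f a b l : is_derive (fun y => f a y) b l -> d_b f a b = l.
Proof. exact (is_derive_unique _ b l). Qed.

Lemma d_aa_of f f1 a b l :
  locally a (fun x => is_derive (fun t => f t b) x (f1 x)) ->
  is_derive f1 a l -> d_aa f a b = l.
Proof.
intros H1 H2; change (Derive (fun x => Derive (fun t => f t b) x) a = l).
rewrite <- (is_derive_unique _ _ _ H2); apply Derive_ext_loc.
revert H1; apply filter_imp; intros x; apply is_derive_unique.
Qed.

Lemma d_bb_of f f1 a b l :
  locally b (fun y => is_derive (fun t => f a t) y (f1 y)) ->
  is_derive f1 b l -> d_bb f a b = l.
Proof. exact (d_aa_of (fun y x => f x y) f1 b a l). Qed.

(** [partial_derive 1 1] differentiates in b first, so the b-derivative at fixed b has to be known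
    for all first arguments near a. *)
Lemma d_ab_of f f1 a b l :
  locally a (fun x => is_derive (fun y => f x y) b (f1 x)) ->
  is_derive f1 a l -> d_ab f a b = l.
Proof.
intros H1 H2; change (Derive (fun x => Derive (fun t => f x t) b) a = l).
rewrite <- (is_derive_unique _ _ _ H2); apply Derive_ext_loc.
revert H1; apply filter_imp; intros x; apply is_derive_unique.
Qed.

(** * Factorised forms of F and w *)

Definition velocity s a b := sign s * Rpower (sqrt (a ^ 2 + b ^ 2)) s.

Definition pinching s a b :=
  (a - b) ^ 2 * (a ^ 3 + b ^ 3) * Rpower (a * b) s
  / (sqrt (a ^ 2 + b ^ 2) * (a * b) ^ 2).

Definition sqs a b := a ^ 2 + b ^ 2.
Definition cubes a b := a ^ 3 + b ^ 3.

Lemma sqs_pos a b : 0 < a -> 0 < b -> 0 < sqs a b.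
Proof. intros Ha Hb; pose proof (pow_lt a 2 Ha); pose proof (pow_lt b 2 Hb); unfold sqs; lra. Qed.

Lemma cubes_pos a b : 0 < a -> 0 < b -> 0 < cubes a b.
Proof. intros Ha Hb; pose proof (pow_lt a 3 Ha); pose proof (pow_lt b 3 Hb); unfold cubes; lra. Qed.

Lemma sqs_sym a b : sqs a b = sqs b a.
Proof. unfold sqs; ring. Qed.

Lemma cubes_sym a b : cubes a b = cubes b a.
Proof. unfold cubes; ring. Qed.

(** The non-polynomial factor of w. It is positive and symmetric, so it factors out of every sign
    condition. *)
Definition weight s a b := Rpower (a * b) (s - 2) * Rpower (sqs a b) (- / 2).

(** The common factor of F_a and F_b, which are this times a and b respectively. *)
Definition velocity_weight s a b := - s * Rpower (sqs a b) (s / 2 - 1).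

Lemma weight_pos s a b : 0 < weight s a b.
Proof. apply Rmult_lt_0_compat; apply exp_pos. Qed.

Lemma weight_sym s a b : weight s a b = weight s b a.
Proof. unfold weight; now rewrite (Rmult_comm a b), sqs_sym. Qed.

Lemma velocity_weight_pos s a b : s < 0 -> 0 < velocity_weight s a b.
Proof. intros Hs; apply Rmult_lt_0_compat; [lra|apply exp_pos]. Qed.

Lemma velocity_weight_sym s a b : velocity_weight s a b = velocity_weight s b a.
Proof. unfold velocity_weight; now rewrite sqs_sym. Qed.

Lemma velocityE s a b : s < 0 -> 0 < a -> 0 < b ->
  velocity s a b = - Rpower (sqs a b) (s / 2).
Proof.
intros Hs Ha Hb; unfold velocity; fold (sqs a b).
rewrite sign_eq_m1 by easy; rewrite <- Rpower_sqrt by now apply sqs_pos.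
rewrite Rpower_mult; replace (/ 2 * s) with (s / 2) by field; ring.
Qed.

(** Euler's identity s F = a F_a + b F_b; it brings F over the same factor as its derivatives. *)
Lemma velocity_weightE s a b : s < 0 -> 0 < a -> 0 < b ->
  velocity s a b = velocity_weight s a b * sqs a b / s.
Proof.
intros Hs Ha Hb; rewrite velocityE by easy; unfold velocity_weight.
replace (s / 2) with ((s / 2 - 1) + 1) at 1 by ring.
rewrite Rpower_plus, Rpower_1 by now apply sqs_pos.
field; lra.
Qed.

Lemma pinchingE s a b : 0 < a -> 0 < b ->
  pinching s a b = (a - b) ^ 2 * cubes a b * weight s a b.
Proof.
intros Ha Hb; pose proof (Rmult_lt_0_compat _ _ Ha Hb) as Hab.
pose proof (sqs_pos a b Ha Hb) as HN.
unfold pinching, weight; fold (cubes a b) (sqs a b).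
replace s with ((s - 2) + INR 2) at 1 by (simpl; ring).
rewrite Rpower_plus, Rpower_pow, Rpower_Ropp, Rpower_sqrt by easy.
field; split; [pose proof (sqrt_lt_R0 _ HN)|]; nra.
Qed.

Lemma velocity_sym s a b : velocity s a b = velocity s b a.
Proof. unfold velocity; now rewrite (Rplus_comm (a ^ 2)). Qed.

Lemma pinching_sym s a b : 0 < a -> 0 < b -> pinching s a b = pinching s b a.
Proof.
intros Ha Hb; rewrite !pinchingE by easy; rewrite weight_sym, cubes_sym; ring.
Qed.

(** * Logarithmic derivatives of w *)

Definition log_slope s a b :=
  2 / (a - b) + 3 * a ^ 2 / cubes a b + (s - 2) / a - a / sqs a b.

(** The mixed derivative of log w, that is u_b = v_a for u = [log_slope s a b] and v =
    [log_slope s b a]. It does not depend on s, since s enters log w only through s (log a + log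
    b). *)
Definition log_mixed a b :=
  2 / (a - b) ^ 2 - 9 * (a ^ 2 * b ^ 2) / cubes a b ^ 2 + 2 * (a * b) / sqs a b ^ 2.

Ltac quadrant_side := repeat split;
  match goal with
  | |- True => exact I
  | |- cubes ?x ?y <> 0 => apply Rgt_not_eq, cubes_pos; assumption
  | |- sqs ?x ?y <> 0 => apply Rgt_not_eq, sqs_pos; assumption
  | _ => first [assumption | lra]
  end.

(* The quotient [log_slope] has a pole on the diagonal, its product with
   [pinching] does not; this numerator is what survives. *)
Definition slope_poly r q a b :=
  2 * (q + r) * a * cubes a b * sqs a b
  + 3 * (q + r) * a ^ 3 * (a - b) * sqs a b
  - (3 * r + 2 * q) * (a - b) * cubes a b * sqs a b
  - (q + r) * a ^ 2 * (a - b) * cubes a b.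

(** The pole of u is cancelled here, so the formula also holds on the diagonal, where the inequality
    for C is required as well. *)
Lemma is_derive_pinching s a b : 0 < a -> 0 < b ->
  is_derive (fun x => pinching s x b) a
    ((a - b) * slope_poly (- s) (1 + s) a b * weight s a b / (a * sqs a b)).
Proof.
intros Ha Hb.
pose proof (cubes_pos a b Ha Hb) as HK; pose proof (sqs_pos a b Ha Hb) as HN.
apply (is_derive_ext_loc (fun x => (x - b) ^ 2 * cubes x b * weight s x b)).
  apply (filter_imp (fun x => 0 < x)); [|now apply locally_pos].
  intros x Hx; symmetry; now apply pinchingE.
unfold weight, Rpower, slope_poly, cubes, sqs in *; auto_derive.
  repeat split; try easy; nra.
match goal with |- context [exp ?e] => set (E1 := exp e) end.
simpl in *.
match goal with |- context [exp ?e] => set (E2 := exp e) end.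
field. nra.
Qed.

Lemma log_slopeE s a b : 0 < a -> 0 < b -> a <> b ->
  log_slope s a b
  = slope_poly (- s) (1 + s) a b / (a * ((a - b) * cubes a b * sqs a b)).
Proof.
intros Ha Hb Hab; unfold log_slope, slope_poly; field; quadrant_side.
Qed.

Lemma is_derive_pinching_fst s a b : 0 < a -> 0 < b -> a <> b ->
  is_derive (fun x => pinching s x b) a (pinching s a b * log_slope s a b).
Proof.
intros Ha Hb Hab; evar_last; [now apply is_derive_pinching|].
rewrite log_slopeE, pinchingE by easy; field; quadrant_side.
Qed.

Lemma is_derive_pinching_snd s a b : 0 < a -> 0 < b -> a <> b ->
  is_derive (fun y => pinching s a y) b (pinching s a b * log_slope s b a).
Proof.
intros Ha Hb Hab; rewrite (pinching_sym s a b) by easy.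
apply (is_derive_ext_loc (fun y => pinching s y a)).
  apply (filter_imp (fun y => 0 < y)); [|now apply locally_pos].
  intros y Hy; now apply pinching_sym.
now apply is_derive_pinching_fst; auto.
Qed.

Lemma is_derive_log_slope_snd s a b : 0 < a -> 0 < b -> a <> b ->
  is_derive (fun y => log_slope s a y) b (log_mixed a b).
Proof.
intros Ha Hb Hab.
pose proof (cubes_pos a b Ha Hb) as HK; pose proof (sqs_pos a b Ha Hb) as HN.
unfold log_slope, log_mixed, cubes, sqs in *; auto_derive.
  repeat split; simpl in *; lra.
field; repeat split; lra.
Qed.

(** Differentiating Euler's relation a u + b v = 2 s in a gives a u_a = -(u + b v_a). In this form
    all second derivatives of w are expressed by u, v and [log_mixed]. *)
Lemma is_derive_log_slope_fst s a b : 0 < a -> 0 < b -> a <> b ->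
  is_derive (fun x => log_slope s x b) a
    (- (log_slope s a b + b * log_mixed a b) / a).
Proof.
intros Ha Hb Hab.
pose proof (cubes_pos a b Ha Hb) as HK; pose proof (sqs_pos a b Ha Hb) as HN.
unfold log_slope, log_mixed, cubes, sqs in *; auto_derive.
  repeat split; simpl in *; lra.
field; repeat split; lra.
Qed.

Lemma locally_pos_neq a b : 0 < a -> a <> b -> locally a (fun x => 0 < x /\ x <> b).
Proof.
intros Ha Hab; apply filter_and; [now apply locally_pos|].
exact (open_neq b a Hab).
Qed.

Lemma log_mixed_sym a b : log_mixed a b = log_mixed b a.
Proof.
unfold log_mixed; rewrite (cubes_sym a b), (sqs_sym a b).
replace ((a - b) ^ 2) with ((b - a) ^ 2) by ring.
now rewrite (Rmult_comm a b), (Rmult_comm (a ^ 2) (b ^ 2)).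
Qed.

Lemma d_a_pinching s a b : 0 < a -> 0 < b ->
  d_a (pinching s) a b
  = (a - b) * slope_poly (- s) (1 + s) a b * weight s a b / (a * sqs a b).
Proof. now intros; apply d_a_of, is_derive_pinching. Qed.

Lemma d_b_pinching s a b : 0 < a -> 0 < b ->
  d_b (pinching s) a b = d_a (pinching s) b a.
Proof.
intros Ha Hb; rewrite d_a_pinching by easy; apply d_b_of.
apply (is_derive_ext_loc (fun y => pinching s y a)).
  apply (filter_imp (fun y => 0 < y)); [|now apply locally_pos].
  intros y Hy; now apply pinching_sym.
now apply is_derive_pinching.
Qed.

Section OffDiagonal.

Variables s a b : R.
Hypotheses (Ha : 0 < a) (Hb : 0 < b) (Hab : a <> b).

Lemma d_a_pinching_log : d_a (pinching s) a b = pinching s a b * log_slope s a b.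
Proof. now apply d_a_of, is_derive_pinching_fst. Qed.

Lemma d_b_pinching_log : d_b (pinching s) a b = pinching s a b * log_slope s b a.
Proof. now apply d_b_of, is_derive_pinching_snd. Qed.

(** From w_a = w u one gets w_aa = w (u^2 + u_a); the other two second derivatives follow the same
    pattern. *)
Lemma d_aa_pinching : d_aa (pinching s) a b
  = pinching s a b
    * (log_slope s a b ^ 2 - (log_slope s a b + b * log_mixed a b) / a).
Proof.
apply (d_aa_of _ (fun x => pinching s x b * log_slope s x b)).
  eapply filter_imp; [|exact (locally_pos_neq a b Ha Hab)].
  now intros x [Hx Hxb]; apply is_derive_pinching_fst.
evar_last.
  apply (is_derive_mult (fun x => pinching s x b) (fun x => log_slope s x b)).
  - now apply is_derive_pinching_fst.
  - now apply is_derive_log_slope_fst.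
  - exact Rmult_comm.
unfold plus, mult; simpl; field; lra.
Qed.

Lemma d_ab_pinching : d_ab (pinching s) a b
  = pinching s a b * (log_slope s a b * log_slope s b a + log_mixed a b).
Proof.
apply (d_ab_of _ (fun x => pinching s x b * log_slope s b x)).
  eapply filter_imp; [|exact (locally_pos_neq a b Ha Hab)].
  now intros x [Hx Hxb]; apply is_derive_pinching_snd.
evar_last.
  apply (is_derive_mult (fun x => pinching s x b) (fun x => log_slope s b x)).
  - now apply is_derive_pinching_fst.
  - now apply is_derive_log_slope_snd; auto.
  - exact Rmult_comm.
rewrite (log_mixed_sym b a); unfold plus, mult; simpl; ring.
Qed.

Lemma d_bb_pinching : d_bb (pinching s) a b
  = pinching s a b
    * (log_slope s b a ^ 2 - (log_slope s b a + a * log_mixed a b) / b).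
Proof.
apply (d_bb_of _ (fun y => pinching s a y * log_slope s y a)).
  eapply filter_imp; [|exact (locally_pos_neq b a Hb (not_eq_sym Hab))].
  now intros y [Hy Hya]; apply is_derive_pinching_snd; auto.
evar_last.
  apply (is_derive_mult (fun y => pinching s a y) (fun y => log_slope s y a)).
  - now apply is_derive_pinching_snd.
  - now apply is_derive_log_slope_fst; auto.
  - exact Rmult_comm.
rewrite (log_mixed_sym b a); unfold plus, mult; simpl; field; lra.
Qed.

End OffDiagonal.

(** * Derivatives of the velocity *)

Lemma is_derive_velocity_fst s a b : s < 0 -> 0 < a -> 0 < b ->
  is_derive (fun x => velocity s x b) a (velocity_weight s a b * a).
Proof.
intros Hs Ha Hb.
apply (is_derive_ext_loc (fun x => - Rpower (sqs x b) (s / 2))).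
  apply (filter_imp (fun x => 0 < x)); [|now apply locally_pos].
  intros x Hx; symmetry; now apply velocityE.
evar_last.
  apply (is_derive_opp (fun x => Rpower (sqs x b) (s / 2))).
  apply (is_derive_comp (fun t => Rpower t (s / 2)) (fun x => sqs x b)).
  - now apply is_derive_Rpower, sqs_pos.
  - unfold sqs; auto_derive; [easy|reflexivity].
unfold velocity_weight, opp, scal; simpl; unfold mult; simpl; field.
Qed.

Lemma is_derive_velocity_weight_fst s a b : 0 < a -> 0 < b ->
  is_derive (fun x => velocity_weight s x b) a
    (velocity_weight s a b * (s - 2) * a / sqs a b).
Proof.
intros Ha Hb.
pose proof (sqs_pos a b Ha Hb) as HN; evar_last.
  apply (is_derive_scal (fun x => Rpower (sqs x b) (s / 2 - 1))).
  apply (is_derive_comp (fun t => Rpower t (s / 2 - 1)) (fun x => sqs x b)).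
  - now apply is_derive_Rpower.
  - unfold sqs; auto_derive; [easy|reflexivity].
unfold velocity_weight, scal; simpl; unfold mult; simpl.
(* The third occurrence is the exponent on the right-hand side; splitting one power of [sqs] off it
   cancels the denominator. *)
replace (s / 2 - 1) with ((s / 2 - 1 - 1) + 1) at 3 by ring.
rewrite Rpower_plus, Rpower_1 by easy; field; lra.
Qed.

Lemma d_a_velocity s a b : s < 0 -> 0 < a -> 0 < b ->
  d_a (velocity s) a b = velocity_weight s a b * a.
Proof. intros Hs Ha Hb; now apply d_a_of, is_derive_velocity_fst. Qed.

Lemma is_derive_velocity_snd s a b : s < 0 -> 0 < a -> 0 < b ->
  is_derive (fun y => velocity s a y) b (velocity_weight s a b * b).
Proof.
intros Hs Ha Hb.
apply (is_derive_ext (fun y => velocity s y a)); [intros; apply velocity_sym|].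
rewrite velocity_weight_sym; now apply is_derive_velocity_fst.
Qed.

Lemma d_b_velocity s a b : s < 0 -> 0 < a -> 0 < b ->
  d_b (velocity s) a b = velocity_weight s a b * b.
Proof. intros Hs Ha Hb; now apply d_b_of, is_derive_velocity_snd. Qed.

Lemma d_aa_velocity s a b : s < 0 -> 0 < a -> 0 < b ->
  d_aa (velocity s) a b
  = velocity_weight s a b * (1 + (s - 2) * a ^ 2 / sqs a b).
Proof.
intros Hs Ha Hb.
apply (d_aa_of _ (fun x => velocity_weight s x b * x)).
  apply (filter_imp (fun x => 0 < x)); [|now apply locally_pos].
  now intros x Hx; apply is_derive_velocity_fst.
evar_last.
  apply (is_derive_mult (fun x => velocity_weight s x b) (fun x => x)).
  - now apply is_derive_velocity_weight_fst.
  - apply (is_derive_id (K := R_AbsRing)).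
  - exact Rmult_comm.
unfold plus, mult, one; simpl; field; quadrant_side.
Qed.

Lemma d_bb_velocity s a b : s < 0 -> 0 < a -> 0 < b -> d_bb (velocity s) a b
  = velocity_weight s a b * (1 + (s - 2) * b ^ 2 / sqs a b).
Proof.
intros Hs Ha Hb; rewrite velocity_weight_sym, sqs_sym.
rewrite <- (d_aa_velocity s b a Hs Hb Ha).
change (Derive_n (fun y => velocity s a y) 2 b = Derive_n (fun y => velocity s y a) 2 b).
apply Derive_n_ext; intros; apply velocity_sym.
Qed.

Lemma d_ab_velocity s a b : s < 0 -> 0 < a -> 0 < b -> d_ab (velocity s) a b
  = velocity_weight s a b * ((s - 2) * a * b / sqs a b).
Proof.
intros Hs Ha Hb.
apply (d_ab_of _ (fun x => velocity_weight s x b * b)).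
  apply (filter_imp (fun x => 0 < x)); [|now apply locally_pos].
  now intros x Hx; apply is_derive_velocity_snd.
apply (is_derive_ext (fun x => b * velocity_weight s x b)).
  intros; apply Rmult_comm.
evar_last.
  apply (is_derive_scal (fun x => velocity_weight s x b)).
  now apply is_derive_velocity_weight_fst.
unfold scal; simpl; unfold mult; simpl; field; quadrant_side.
Qed.

(** * The polynomials behind the sign conditions *)

(** Numerator of [log_mixed] over the square of (a - b) * [cubes a b] * [sqs a b]. *)
Definition mixed_poly a b :=
  2 * (cubes a b * sqs a b) ^ 2 - 9 * (a * b * (a - b) * sqs a b) ^ 2
  + 2 * (a * b) * ((a - b) * cubes a b) ^ 2.

(* With [- slope_poly r q b a] for the numerator of the second logarithmic
   slope, this is the numerator of [E_term] at [sigma = - r], homogenised in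
   [(r, q)] by writing [1] as [q + r]. *)
Definition E_poly r q a b :=
  let x := slope_poly r q a b in
  let y := - slope_poly r q b a in
  let z := a ^ 2 * y - b ^ 2 * x in
  (a - b) *
    ((q + r) * (x ^ 3 * b ^ 2 + 2 * x * y ^ 2 * a ^ 2 + x ^ 2 * y * a ^ 2
      + 4 * r ^ 2 * (q + r) * mixed_poly a b
        * ((a - b) * cubes a b * sqs a b) * a ^ 3 * b) * sqs a b
     - (3 * r + 2 * q) * x * z ^ 2)
  + 2 * (q + r) * z * x ^ 2 * b * sqs a b.

(** What is left of [C_term] after removing (a - b)^2 and a factor of the sign of s. It has degree 2
    in (r, q); the factor 1 - s appears as q + 2 r. *)
Definition C_poly r q a b :=
  2 * r ^ 2 * cubes a b ^ 2
  + (q + 2 * r) * ((q + r) * (3 * (a ^ 4 + b ^ 4) * sqs a b - cubes a b ^ 2)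
                   - r * (a + b) * cubes a b * sqs a b).

(** No minus sign survives the expansion, so the descent through sums, products and powers ends at
    variables and numerals. *)
Ltac expand_nonneg :=
  match goal with |- 0 <= ?e => ring_simplify e end;
  repeat first [ apply Rplus_le_le_0_compat | apply Rmult_le_pos
               | apply pow_le | lra ].

(* On each side of the diagonal, in terms of [r], [q], the smaller argument
   and the difference [t] of the arguments, every coefficient is nonnegative. *)
Section Positivity.

Variables r q b t : R.
Hypotheses (Hr : 0 <= r) (Hq : 0 <= q) (Hb : 0 <= b) (Ht : 0 <= t).

(** Nonnegative coefficients alone would give only a weak inequality. The subtracted term is an
    eighth of the diagonal value 8 (q + r) b^6 and supplies strictness. *)
Lemma slope_poly_above : 0 <= slope_poly r q (b + t) b - (q + r) * b ^ 6.
Proof. unfold slope_poly, cubes, sqs; expand_nonneg. Qed.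

Lemma slope_poly_below : 0 <= slope_poly r q b (b + t) - (q + r) * b ^ 6.
Proof. unfold slope_poly, cubes, sqs; expand_nonneg. Qed.

Lemma E_poly_above : 0 <= - E_poly r q (b + t) b.
Proof. unfold E_poly, mixed_poly, slope_poly, cubes, sqs; expand_nonneg. Qed.

Lemma E_poly_below : 0 <= - E_poly r q b (b + t).
Proof. unfold E_poly, mixed_poly, slope_poly, cubes, sqs; expand_nonneg. Qed.

Lemma C_poly_above : 0 <= C_poly r q (b + t) b.
Proof. unfold C_poly, cubes, sqs; expand_nonneg. Qed.

End Positivity.

Lemma C_poly_sym r q a b : C_poly r q a b = C_poly r q b a.
Proof. unfold C_poly, cubes, sqs; ring. Qed.

(** The range of s is what makes r = -s and q = 1 + s nonnegative; as q + r = 1, the margin is the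
    sixth power of the smaller argument. *)
Lemma slope_poly_pos s a b : -1 <= s <= 0 -> 0 < a -> 0 < b ->
  0 < slope_poly (- s) (1 + s) a b.
Proof.
intros Hs Ha Hb; destruct (Rle_lt_dec b a) as [H|H].
- assert (P := slope_poly_above (- s) (1 + s) b (a - b)).
  replace (b + (a - b)) with a in P by ring.
  pose proof (pow_lt b 6 Hb); lra.
- assert (P := slope_poly_below (- s) (1 + s) a (b - a)).
  replace (a + (b - a)) with b in P by ring.
  pose proof (pow_lt a 6 Ha); lra.
Qed.

Lemma E_poly_le0 s a b : -1 <= s <= 0 -> 0 < a -> 0 < b ->
  E_poly (- s) (1 + s) a b <= 0.
Proof.
intros Hs Ha Hb; destruct (Rle_lt_dec b a) as [H|H].
- assert (P := E_poly_above (- s) (1 + s) b (a - b)).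
  replace (b + (a - b)) with a in P by ring; lra.
- assert (P := E_poly_below (- s) (1 + s) a (b - a)).
  replace (a + (b - a)) with b in P by ring; lra.
Qed.

Lemma C_poly_ge0 s a b : -1 <= s <= 0 -> 0 < a -> 0 < b ->
  0 <= C_poly (- s) (1 + s) a b.
Proof.
intros Hs Ha Hb; destruct (Rle_lt_dec b a) as [H|H]; [|rewrite C_poly_sym].
- assert (P := C_poly_above (- s) (1 + s) b (a - b)).
  replace (b + (a - b)) with a in P by ring; lra.
- assert (P := C_poly_above (- s) (1 + s) a (b - a)).
  replace (a + (b - a)) with b in P by ring; lra.
Qed.

(** * Signs of w and w_a, and the inequalities for C, E and G *)

Lemma pinching_pos s a b : 0 < a -> 0 < b -> a <> b -> 0 < pinching s a b.
Proof.
intros Ha Hb Hab; rewrite pinchingE by easy.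
apply Rmult_lt_0_compat; [|apply weight_pos].
apply Rmult_lt_0_compat; [|now apply cubes_pos].
apply pow2_gt_0; lra.
Qed.

(** One factorisation serves both halves of the monotonicity condition and the nonvanishing of w_a
    off the diagonal. *)
Lemma d_a_pinching_sign s a b : -1 <= s <= 0 -> 0 < a -> 0 < b ->
  exists k, 0 < k /\ d_a (pinching s) a b = (a - b) * k.
Proof.
intros Hs Ha Hb.
exists (slope_poly (- s) (1 + s) a b * weight s a b / (a * sqs a b)); split.
- apply Rdiv_lt_0_compat; apply Rmult_lt_0_compat; try easy.
  + now apply slope_poly_pos.
  + apply weight_pos.
  + now apply sqs_pos.
- rewrite d_a_pinching by easy; unfold Rdiv; ring.
Qed.

Lemma d_a_pinching_neq0 s a b : -1 <= s <= 0 -> 0 < a -> 0 < b -> a <> b ->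
  d_a (pinching s) a b <> 0.
Proof.
intros Hs Ha Hb Hab; destruct (d_a_pinching_sign s a b Hs Ha Hb) as [k [Hk ->]].
apply Rmult_integral_contrapositive_currified; lra.
Qed.

(** Both w_a and w_b carry a factor a - b, with opposite signs; the remaining bracket is
    antisymmetric in (a, b), which yields the second such factor. The division by s comes from
    Euler's identity for F and makes the prefactor nonpositive. *)
Lemma C_term_pinching s a b : -1 <= s < 0 -> 0 < a -> 0 < b ->
  C_term (velocity s) (pinching s) a b
  = velocity_weight s a b * weight s a b * (a - b) ^ 2 / s
    * C_poly (- s) (1 + s) a b.
Proof.
intros Hs Ha Hb; unfold C_term.
rewrite d_b_pinching, !d_a_pinching, d_a_velocity, d_b_velocity by lra.
rewrite velocity_weightE by lra.
rewrite (weight_sym s b a), (sqs_sym b a).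
pose proof (sqs_pos a b Ha Hb) as HN.
unfold slope_poly, C_poly, cubes, sqs in *; field; lra.
Qed.

Section OffDiagonalE.

Variables s a b : R.
Hypotheses (Hs : -1 <= s < 0) (Ha : 0 < a) (Hb : 0 < b) (Hab : a <> b).

Lemma log_slope_neq0 : log_slope s b a <> 0.
Proof.
intros H; apply (d_a_pinching_neq0 s b a); [lra|easy|easy|auto|].
rewrite d_a_pinching_log by auto; rewrite H; ring.
Qed.

Lemma alpha_pinching : alpha (pinching s) a b = - (log_slope s a b / log_slope s b a).
Proof.
unfold alpha; rewrite d_a_pinching_log, d_b_pinching_log by easy; field.
split; [apply log_slope_neq0|now apply Rgt_not_eq, pinching_pos].
Qed.

(** Euler's relation for w, which has degree 2 s. Its square is the source of 4 r^2 in [E_poly]. *)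
Lemma log_slope_Euler : a * log_slope s a b + b * log_slope s b a = 2 * s.
Proof.
pose proof (sqs_pos a b Ha Hb); pose proof (cubes_pos a b Ha Hb).
unfold log_slope, cubes, sqs in *; field; repeat split; lra.
Qed.

Lemma E_term_pinching : E_term (velocity s) (pinching s) a b
  = pinching s a b * velocity_weight s a b / log_slope s b a ^ 2
    * (E_poly (- s) (1 + s) a b
       / (((a - b) ^ 2) ^ 2 * (cubes a b * sqs a b) ^ 3 * a ^ 3 * b ^ 2 * sqs a b)).
Proof.
pose proof log_slope_neq0 as Hv; pose proof (sqs_pos a b Ha Hb) as HN.
pose proof (cubes_pos a b Ha Hb) as HK.
(* With alpha = -u / v the terms (u + alpha v)^2 vanish, and the three contributions of [log_mixed]
   assemble into the square (a u + b v)^2, which is 4 s^2 by Euler's relation. *)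
transitivity (pinching s a b * velocity_weight s a b / log_slope s b a ^ 2 *
  (log_slope s a b ^ 3 + 2 * log_slope s a b * log_slope s b a ^ 2
   + (s - 2) * log_slope s a b * (a * log_slope s b a - b * log_slope s a b) ^ 2
     / sqs a b
   + a * log_slope s a b ^ 2 * log_slope s b a / b
   + log_mixed a b / b * (a * log_slope s a b + b * log_slope s b a) ^ 2
   + 2 * (a * log_slope s b a - b * log_slope s a b) * log_slope s a b ^ 2
     / (a - b))).
- unfold E_term, D2_alpha; rewrite alpha_pinching.
  rewrite d_a_pinching_log, d_b_pinching_log, d_aa_pinching, d_ab_pinching,
    d_bb_pinching by easy.
  rewrite d_a_velocity, d_b_velocity, d_aa_velocity, d_ab_velocity,
    d_bb_velocity by lra.
  field; repeat split; lra.
- apply f_equal; rewrite log_slope_Euler.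
  rewrite !log_slopeE by auto; unfold log_mixed, E_poly, mixed_poly.
  rewrite (cubes_sym b a), (sqs_sym b a).
  field; repeat split; lra.
Qed.

Lemma E_term_le0 : E_term (velocity s) (pinching s) a b <= 0.
Proof.
rewrite E_term_pinching.
pose proof (E_poly_le0 s a b ltac:(lra) Ha Hb) as HE.
pose proof (pow2_gt_0 _ log_slope_neq0).
assert (0 < (a - b) ^ 2) by (apply pow2_gt_0; lra).
pose proof (sqs_pos a b Ha Hb); pose proof (cubes_pos a b Ha Hb).
pose proof (pinching_pos s a b Ha Hb Hab).
assert (0 < velocity_weight s a b) by (apply velocity_weight_pos; lra).
rewrite <- (Rmult_0_r (pinching s a b * velocity_weight s a b / log_slope s b a ^ 2)).
apply Rmult_le_compat_l.
  apply Rlt_le, Rdiv_lt_0_compat; [now apply Rmult_lt_0_compat|easy].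
apply Rmult_le_0_r; [easy|]; apply Rlt_le, Rinv_0_lt_compat.
repeat first [assumption | apply pow_lt | apply Rmult_lt_0_compat].
Qed.

End OffDiagonalE.

(** Exchanging the arguments exchanges u and v and hence turns alpha into 1 / alpha; the prefactor 1
    / alpha^2 of G accounts for the change in the quadratic forms. *)
Lemma G_term_swap s a b : -1 <= s < 0 -> 0 < a -> 0 < b -> a <> b ->
  G_term (velocity s) (pinching s) a b = E_term (velocity s) (pinching s) b a.
Proof.
intros Hs Ha Hb Hab; unfold G_term, E_term, D2_alpha.
assert (log_slope s a b <> 0) by (apply log_slope_neq0; auto).
assert (log_slope s b a <> 0) by (apply log_slope_neq0; auto).
rewrite !alpha_pinching by auto.
rewrite !d_a_pinching_log, !d_b_pinching_log, !d_aa_pinching, !d_ab_pinching,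
  !d_bb_pinching by auto.
rewrite !d_a_velocity, !d_b_velocity, !d_aa_velocity, !d_ab_velocity,
  !d_bb_velocity by lra.
rewrite (velocity_weight_sym s b a), (sqs_sym b a), (log_mixed_sym b a),
  (pinching_sym s b a) by easy.
pose proof (sqs_pos a b Ha Hb).
field; repeat split; lra.
Qed.

(** * Asymptotics of alpha near the boundary *)

Lemma eq_up_to_o_inv_vanishing f g h :
  at_right 0 (fun x => f x - g x = h x / x) ->
  filterlim h (at_right 0) (locally 0) -> eq_up_to_o_inv f g.
Proof.
intros Hfg Hh eps.
assert (Hh' : at_right 0 (fun x => ball 0 eps (h x))) by exact (Hh _ (locally_ball 0 eps)).
generalize (filter_and _ _ Hfg Hh'); apply filter_imp; intros x [E B].
rewrite E; unfold Rdiv; change (Rabs (h x * / x) <= eps * Rabs (/ x)).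
rewrite Rabs_mult; apply Rmult_le_compat_r; [apply Rabs_pos|].
apply Rlt_le; replace (h x) with (h x - 0) by ring; exact B.
Qed.

Lemma at_right_lt x0 eps : 0 < eps -> at_right x0 (fun x => x0 < x < x0 + eps).
Proof.
intros He; exists (mkposreal eps He); intros x B Hx; simpl in B.
apply Rabs_def2 in B; unfold minus, plus, opp in B; simpl in B; lra.
Qed.

(** With alpha = phi / x, the error in the derivative is (phi' - (phi - phi 0) / x) / x. Both phi'
    and the difference quotient tend to phi' at 0, so their difference vanishes in the limit; this
    is where continuity of phi' enters. *)
Lemma alpha_first_order_of_C1 w phi dphi :
  at_right 0 (fun x => alpha w x 1 = phi x / x) ->
  locally 0 (fun x => is_derive phi x (dphi x)) ->
  continuous dphi 0 ->
  alpha_first_order w (phi 0).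
Proof.
intros Hw Hd Hc.
assert (H0 : is_derive phi 0 (dphi 0)) by exact (locally_singleton _ _ Hd).
split.
- apply eq_up_to_o_inv_vanishing with (fun x => phi x - phi 0).
    revert Hw; apply filter_imp; intros x ->; unfold Rdiv; ring.
  (* The limit is written as the value of the function at 0, the shape [continuous] expects. *)
  replace 0 with (phi 0 - phi 0) at 2 by ring.
  intros P HP; apply (filter_le_within (F := locally 0) (fun x => 0 < x)).
  revert P HP; change (continuous (fun x => phi x - phi 0) 0).
  apply (continuous_minus phi (fun _ => phi 0)); [|apply continuous_const].
  now apply (ex_derive_continuous phi); exists (dphi 0).
- apply eq_up_to_o_inv_vanishing with (fun x => dphi x - (phi x - phi 0) / x).
    destruct Hw as [d1 Hw]; destruct Hd as [d2 Hd].
    generalize (at_right_lt 0 _ (Rmin_pos _ _ (cond_pos d1) (cond_pos d2))).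
    apply filter_imp; intros x [Hx Hxd]; rewrite Rplus_0_l in Hxd.
    pose proof (Rmin_l d1 d2); pose proof (Rmin_r d1 d2).
    assert (Bx : forall d : posreal, x < d -> ball 0 d x).
      intros d Hd'; apply Rabs_def1; unfold minus, plus, opp; simpl; lra.
    rewrite (d_a_of (alpha w) x 1 (dphi x / x - phi x / x ^ 2)).
      field; lra.
    apply (is_derive_ext_loc (fun t => phi t / t)).
      assert (L : locally x (fun t => 0 < t < d1)).
        apply filter_and; [now apply locally_pos|].
        apply (open_lt d1); lra.
      revert L; apply filter_imp; intros t Ht; symmetry; apply Hw; [|easy].
      apply Rabs_def1; unfold minus, plus, opp; simpl; lra.
    assert (Hdx : is_derive phi x (dphi x)) by (apply Hd, Bx; lra).
    evar_last.
      apply (is_derive_div phi (fun t => t)); [exact Hdx| |lra].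
      apply (is_derive_id (K := R_AbsRing)).
    unfold one; simpl; field; lra.
  intros P [eps HP].
  assert (Hq : at_right 0 (fun x => Rabs ((phi x - phi 0) / x - dphi 0) < eps / 2)).
    apply is_derive_Reals in H0.
    destruct (H0 _ (is_pos_div_2 eps)) as [d Hq].
    generalize (at_right_lt 0 d (cond_pos d)); apply filter_imp; intros x Hx.
    replace (phi x) with (phi (0 + x)) by (f_equal; ring).
    apply Hq; [lra|]; apply Rabs_def1; lra.
  assert (Hr : at_right 0 (fun x => Rabs (dphi x - dphi 0) < eps / 2)).
    apply (filter_le_within (F := locally 0) (fun x => 0 < x)).
    exact (Hc _ (locally_ball (dphi 0) (pos_div_2 eps))).
  change (at_right 0 (fun x => P (dphi x - (phi x - phi 0) / x))).
  generalize (filter_and _ _ Hq Hr); apply filter_imp; intros x [Bq Br].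
  apply HP; apply Rabs_def2 in Bq; apply Rabs_def2 in Br.
  apply Rabs_def1; unfold minus, plus, opp; simpl; lra.
Qed.

Definition slope_poly_at1 s x :=
  (2 - s) + s * x + (3 - s) * x ^ 2 - 2 * x ^ 3 + (3 + s) * x ^ 4 - s * x ^ 5
  + (2 + s) * x ^ 6.

Definition slope_poly_at1' s x :=
  s + 2 * (3 - s) * x - 6 * x ^ 2 + 4 * (3 + s) * x ^ 3 - 5 * s * x ^ 4
  + 6 * (2 + s) * x ^ 5.

Lemma is_derive_slope_poly_at1 s x :
  is_derive (slope_poly_at1 s) x (slope_poly_at1' s x).
Proof. unfold slope_poly_at1, slope_poly_at1'; auto_derive; [easy|ring]. Qed.

Lemma slope_poly_1_r s x : slope_poly (- s) (1 + s) x 1 = slope_poly_at1 s x.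
Proof. unfold slope_poly, slope_poly_at1, cubes, sqs; ring. Qed.

(** As a function of s, the slope polynomial is a symmetric part plus s times the antisymmetric (a -
    b) * [cubes a b] * [sqs a b], so exchanging its arguments amounts to changing the sign of s. *)
Lemma slope_poly_1_l s x : slope_poly (- s) (1 + s) 1 x = slope_poly_at1 (- s) x.
Proof. unfold slope_poly, slope_poly_at1, cubes, sqs; ring. Qed.

Lemma continuous_slope_poly_at1 s x : continuous (slope_poly_at1 s) x.
Proof.
apply (ex_derive_continuous (slope_poly_at1 s)); eexists.
apply is_derive_slope_poly_at1.
Qed.

Lemma continuous_slope_poly_at1' s x : continuous (slope_poly_at1' s) x.
Proof.
apply (ex_derive_continuous (slope_poly_at1' s)).
unfold slope_poly_at1'; auto_derive; easy.
Qed.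

Lemma alpha_pinching_1 s x : -1 <= s < 0 -> 0 < x < 1 ->
  alpha (pinching s) x 1 = slope_poly_at1 s x / slope_poly_at1 (- s) x / x.
Proof.
intros Hs Hx; unfold alpha.
rewrite d_b_pinching, !d_a_pinching by lra.
rewrite (weight_sym s 1 x), (sqs_sym 1 x), <- slope_poly_1_l, <- slope_poly_1_r.
pose proof (slope_poly_pos s 1 x); pose proof (weight_pos s x 1).
pose proof (sqs_pos x 1); field; repeat split; lra.
Qed.

Lemma alpha_pinching_first_order s : -1 <= s < 0 ->
  alpha_first_order (pinching s) ((2 - s) / (2 + s)).
Proof.
intros Hs.
set (p := slope_poly_at1 s); set (q := slope_poly_at1 (- s)).
set (p' := slope_poly_at1' s); set (q' := slope_poly_at1' (- s)).
(* The constant terms are p 0 = 2 - s and q 0 = 2 + s, the latter at least 1. *)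
assert (Hq : q 0 <> 0) by (unfold q, slope_poly_at1; lra).
replace ((2 - s) / (2 + s)) with (p 0 / q 0)
  by (unfold p, q, slope_poly_at1; field; lra).
apply (alpha_first_order_of_C1 _ (fun x => p x / q x)
         (fun x => (p' x * q x - p x * q' x) * / (q x ^ 2))).
- generalize (at_right_lt 0 1 Rlt_0_1); apply filter_imp; intros x Hx.
  apply alpha_pinching_1; lra.
- assert (Lq : locally 0 (fun x => q x <> 0)).
    exact (continuous_slope_poly_at1 (- s) 0 _ (open_neq 0 _ Hq)).
  revert Lq; apply filter_imp; intros x Hx.
  exact (is_derive_div p q x _ _ (is_derive_slope_poly_at1 s x)
           (is_derive_slope_poly_at1 (- s) x) Hx).
- apply (continuous_mult (fun x => p' x * q x - p x * q' x) (fun x => / (q x ^ 2))).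
    apply (continuous_minus (fun x => p' x * q x) (fun x => p x * q' x)).
      apply (continuous_mult p' q);
        [apply continuous_slope_poly_at1'|apply continuous_slope_poly_at1].
    apply (continuous_mult p q');
      [apply continuous_slope_poly_at1|apply continuous_slope_poly_at1'].
  apply continuous_Rinv_comp; [|now apply pow_nonzero].
  unfold q, slope_poly_at1; apply (ex_derive_continuous (V := R_NormedModule)).
  auto_derive; easy.
Qed.

(** * Regularity and homogeneity of F and w *)

Ltac smooth := repeat first
  [ apply smooth_const | apply smooth_fst | apply smooth_snd
  | apply smooth_plus | apply smooth_mult | apply smooth_Rpower ].

Lemma C2_velocity s : s < 0 -> C2_quadrant (velocity s).
Proof.
intros Hs.
apply (C2_quadrant_smooth _ (fun a b => -1 * Rpower (a * a + b * b) (s / 2))).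
  smooth; intros; nra.
intros a b Ha Hb; rewrite velocityE by easy.
unfold sqs; replace (a ^ 2 + b ^ 2) with (a * a + b * b); ring.
Qed.

Lemma C2_pinching s : C2_quadrant (pinching s).
Proof.
apply (C2_quadrant_smooth _ (fun a b =>
  (a + -1 * b) * (a + -1 * b) * (a * a * a + b * b * b)
  * (Rpower (a * b) (s - 2) * Rpower (a * a + b * b) (- / 2)))).
  smooth; intros; nra.
intros a b Ha Hb; rewrite pinchingE by easy; unfold weight, cubes, sqs.
replace (a ^ 2 + b ^ 2) with (a * a + b * b); ring.
Qed.

Lemma velocity_neg s a b : s < 0 -> 0 < a -> 0 < b -> velocity s a b < 0.
Proof.
intros Hs Ha Hb; rewrite velocityE by easy; apply Ropp_lt_gt_0_contravar, exp_pos.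
Qed.

Lemma Rpower_mult_sqr t x p : 0 < t -> 0 < x ->
  Rpower (t ^ 2 * x) p = Rpower t (2 * p) * Rpower x p.
Proof.
intros Ht Hx; rewrite <- Rpower_mult_distr by (try apply pow_lt; easy).
rewrite <- (Rpower_pow 2 t), Rpower_mult by easy; now simpl INR.
Qed.

Lemma sqs_scale t a b : sqs (t * a) (t * b) = t ^ 2 * sqs a b.
Proof. unfold sqs; ring. Qed.

Lemma homogeneous_velocity s : s < 0 -> homogeneous_quadrant (velocity s) s.
Proof.
intros Hs t a b Ht Ha Hb.
rewrite !velocityE, sqs_scale by (try apply Rmult_lt_0_compat; easy).
rewrite Rpower_mult_sqr by (try apply sqs_pos; easy).
replace (2 * (s / 2)) with s by field; ring.
Qed.

Lemma homogeneous_pinching s : homogeneous_quadrant (pinching s) (2 * s).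
Proof.
intros t a b Ht Ha Hb.
rewrite !pinchingE by (try apply Rmult_lt_0_compat; easy).
unfold weight; rewrite sqs_scale.
replace (t * a * (t * b)) with (t ^ 2 * (a * b)) by ring.
rewrite !Rpower_mult_sqr by (try apply sqs_pos; try apply Rmult_lt_0_compat; easy).
(* Degree 5 comes from (a - b)^2 * [cubes a b], the rest from the two factors of [weight]. *)
replace (2 * s) with (INR 5 + (2 * (s - 2) + 2 * - / 2)) by (simpl; field).
rewrite !Rpower_plus, Rpower_pow by easy; unfold cubes; ring.
Qed.

Lemma normal_velocity_velocity s : s < 0 -> normal_velocity (velocity s).
Proof.
intros Hs; split.
- now apply C2_velocity.
- intros a b _ _; apply velocity_sym.
- exists s; split; [lra|now apply homogeneous_velocity].
- intros a b Ha Hb; rewrite d_a_velocity, d_b_velocity by easy.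
  pose proof (velocity_weight_pos s a b Hs).
  split; now apply Rmult_lt_0_compat.
Qed.

Lemma C_term_le0 s a b : -1 <= s < 0 -> 0 < a -> 0 < b ->
  C_term (velocity s) (pinching s) a b <= 0.
Proof.
intros Hs Ha Hb; rewrite C_term_pinching by easy.
apply Rmult_le_0_r; [|apply C_poly_ge0; lra].
apply Rmult_le_0_l; [|apply Rlt_le, Rinv_lt_0_compat; lra].
apply Rmult_le_pos; [|apply pow2_ge_0].
apply Rlt_le, Rmult_lt_0_compat; [apply velocity_weight_pos; lra|apply weight_pos].
Qed.

Theorem lemma9p5 :
  forall sigma : R, -1 <= sigma < 0 ->
  maximum_principle_function
    (fun a b => sign sigma * Rpower (sqrt (a ^ 2 + b ^ 2)) sigma)
    (fun a b =>
       (a - b) ^ 2 * (a ^ 3 + b ^ 3) * Rpower (a * b) sigma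
       / (sqrt (a ^ 2 + b ^ 2) * (a * b) ^ 2)).
Proof.
intros s Hs.
change (maximum_principle_function (velocity s) (pinching s)).
(* F is negative, so the clauses about contracting F hold vacuously. *)
assert (Hexp : ~ contracting (velocity s)).
  intros H; pose proof (H 1 1 Rlt_0_1 Rlt_0_1).
  pose proof (velocity_neg s 1 1); lra.
split.
- apply normal_velocity_velocity; lra.
- apply C2_pinching.
- intros a b; apply pinching_sym.
- exists (2 * s); repeat split; [lra|apply homogeneous_pinching|easy|lra].
- apply pinching_pos.
- intros a Ha; rewrite pinchingE by easy; ring.
- intros a b Ha Hab; destruct (d_a_pinching_sign s a b) as [k [Hk ->]]; nra.
- intros a b Hb Hab; destruct (d_a_pinching_sign s a b) as [k [Hk ->]]; nra.
- intros a b; now apply C_term_le0.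
- intros a b Ha Hb Hab; now apply E_term_le0.
- intros a b Ha Hb Hab; rewrite G_term_swap by easy; now apply E_term_le0; auto.
(* c is the limit of rho * alpha(rho, 1) as rho tends to 0; 0 is a default value for d, as the
   first-order alternative is proved. *)
- exists ((2 - s) / (2 + s)), 0; repeat split; [|easy|].
    apply Rdiv_lt_0_compat; lra.
  intros _; left; now apply alpha_pinching_first_order.
Qed.
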